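(* Let Problem $(M)$, its Pontryagin Hamiltonian $H$, its extremals, and the notions of zero-Hamiltonian arc, singular arc and infinite-order singular arc be as defined in the context. Then: (1) every extremal of Problem $(M)$ is a zero-Hamiltonian singular arc, i.e. it is a singular arc and $H=0$ along it for $t\in[t_0,t_f]$; (2) every singular arc of Problem $(M)$ is of infinite order.
   Context: Let $N_x\ge 1$, $N_e\ge 0$ be integers, $E:\mathbb{R}^{N_x}\to\mathbb{R}$ and $e:\mathbb{R}^{N_x}\to\mathbb{R}^{N_e}$ twice continuously differentiable, $e^L\le e^U$ in $\mathbb{R}^{N_e}$, and $(x^0,t^0)\in\mathbb{R}^{N_x}\times\mathbb{R}$. Write $\partial_x E$ for the gradient of $E$ and $\partial_x e$ for the Jacobian of $e$. For $\nu^0\in\mathbb{R}$, $\nu\in\mathbb{R}^{N_e}$ put $L(\nu^0,\nu,x):=\nu^0E(x)+\nu\cdot e(x)$, with gradient $\partial_xL$ and Hessian $\partial_x^2L$ in $x$. Problem $(M)$ (free final time $t_f$): minimize $y(t_f)$ over $(x,v,y,s,u,t_f)$, with unconstrained control $u(t)\in\mathbb{R}^{N_x}$, subject to $\dot x=v$, $\dot v=u$, $\dot y=[\partial_xE(x)]\cdot v$, $\dot s=[\partial_xe(x)]\,v$, $(x(t_0),t_0)=(x^0,t^0)$, $(y(t_0),s(t_0))=(E(x^0),e(x^0))$, $v(t_f)=0$, $e^L\le s(t_f)\le e^U$ (and $v(t_0)$ free). Pontryagin Hamiltonian: $H(\lambda_x,\lambda_v,\lambda_y,\lambda_s,x,v,y,s,u):=\lambda_x\cdot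 v+\lambda_v\cdot u+\lambda_y[\partial_xE(x)]\cdot v+\lambda_s\cdot[\partial_xe(x)]v$, where $\lambda_x,\lambda_v\in\mathbb{R}^{N_x}$, $\lambda_y\in\mathbb{R}$, $\lambda_s\in\mathbb{R}^{N_e}$ are the adjoint covectors. Extremal of $(M)$: a feasible trajectory-control pair on $[t_0,t_f]$ together with an adjoint arc and a cost multiplier $\nu_0\ge0$, $(\nu_0,\lambda)$ nontrivial, satisfying Pontryagin's conditions: (i) adjoint equations $\dot\lambda_x=-[\partial_x^2L(\lambda_y,\lambda_s,x)]v$, $\dot\lambda_v=-\lambda_x-\partial_xL(\lambda_y,\lambda_s,x)$, $\dot\lambda_y=0$, $\dot\lambda_s=0$; (ii) Hamiltonian minimization: $u(t)$ minimizes $H$ over $\mathbb{R}^{N_x}$, with first-order condition $\partial_uH=0$ for all $t\in[t_0,t_f]$; (iii) transversality: $\lambda_x(t_f)=0$, $\lambda_v(t_0)=0$, $\lambda_v(t_f)=\nu_v$ for some $\nu_v\in\mathbb{R}^{N_x}$, $\lambda_y(t_f)=\nu_0\ge0$, $\lambda_s(t_f)=\nu_s$, where for each $i=1,\dots,N_e$: $\nu_{s,i}\le0$ if $s_i(t_f)=e_i^L$; $\nu_{s,i}=0$ if $e_i^L<s_i(t_f)<e_i^U$; $\nu_{s,i}\ge0$ if $s_i(t_f)=e_i^U$; $\nu_{s,i}$ unrestricted if $e_i^L=e_i^U$. An extremal is a singular arc if along it $\partial_uH\equiv0$ holds without this condition determining $u$ (i.e. the condition $\partial_uH=0$ does not involve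 $u$). A singular arc is of infinite order if for every $k=0,1,2,\dots$ one has $\frac{d^k}{dt^k}\partial_uH=0$ on $[t_0,t_f]$ and none of these derivatives, computed using the state and adjoint equations, yields an expression for $u$. An arc is zero-Hamiltonian if $H=0$ along it. *)

(* Defs.v *)
From mathcomp Require Import all_boot all_order all_algebra.
From mathcomp Require Import all_classical all_reals all_analysis.

Set Implicit Arguments.
Unset Strict Implicit.
Unset Printing Implicit Defensive.

Import Order.TTheory GRing.Theory Num.Theory.
Import numFieldNormedType.Exports.

Local Open Scope classical_set_scope.
Local Open Scope ring_scope.

(* Elements of R^n are row vectors.  The Jacobian ['J f x] of the library is
   the transpose of the usual one: [v *m 'J f x] is the derivative of [f] at
   [x] in the direction [v], which is written [df/dx] v with columns. *)

Section Calculus.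
Context {R : realType}.

Definition dot n (a b : 'rV[R]_n) : R := \sum_(i < n) a 0 i * b 0 i.

Definition gradient n (f : 'rV[R]_n -> R) (x : 'rV[R]_n) : 'rV[R]_n :=
  \row_(j < n) 'D_(delta_mx 0 j) f x.

Definition hessian n (f : 'rV[R]_n -> R) (x : 'rV[R]_n) : 'M[R]_n :=
  'J (gradient f) x.

Definition C2 n (W : normedModType R) (f : 'rV[R]_n -> W) : Prop :=
  [/\ forall x, differentiable f x,
      forall v x, differentiable ('D_v f) x
    & forall v w, continuous ('D_w ('D_v f))].

(* [f] is absolutely continuous on [a, b] with derivative [f'] almost
   everywhere, in integral form: the Caratheodory meaning of an ODE. *)
Definition ac_deriv (a b : R) (f f' : R -> R) : Prop :=
  (@lebesgue_measure R).-integrable `[a, b] (EFin \o f') /\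
  forall t, t \in `[a, b] ->
    f t = f a + \int[@lebesgue_measure R]_(r in `[a, t]) f' r.

Definition ac_deriv_vec n (a b : R) (f f' : R -> 'rV[R]_n) : Prop :=
  forall i, ac_deriv a b (fun t => f t 0 i) (fun t => f' t 0 i).

(* Derivative at [t] relative to [a, b], hence one-sided at the endpoints. *)
Definition deriv_within (V : normedModType R) (a b : R) (f : R -> V)
    (t : R) (l : V) : Prop :=
  h^-1 *: (f (t + h) - f t)
    @[h --> within [set h | t + h \in `[a, b]] (0 : R)^'] --> l.

Fixpoint nth_deriv_within (V : normedModType R) (a b : R) (k : nat)
    (f g : R -> V) : Prop :=
  match k with
  | 0%N => forall t, t \in `[a, b] -> g t = f t
  | k'.+1 => exists f1 : R -> V, nth_deriv_within a b k' f f1 /\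
      forall t, t \in `[a, b] -> deriv_within a b f1 t (g t)
  end.

End Calculus.

(* Values outside of [arc_ti, arc_tf] are irrelevant. *)
Record lifted_arc (R : realType) (Nx Ne : nat) := Arc {
  arc_ti : R;
  arc_tf : R;
  arc_x : R -> 'rV[R]_Nx;
  arc_v : R -> 'rV[R]_Nx;
  arc_y : R -> R;
  arc_s : R -> 'rV[R]_Ne;
  arc_u : R -> 'rV[R]_Nx;
  arc_lx : R -> 'rV[R]_Nx;
  arc_lv : R -> 'rV[R]_Nx;
  arc_ly : R -> R;
  arc_ls : R -> 'rV[R]_Ne
}.

Section ProblemM.
Context {R : realType} {Nx Ne : nat}.
Context (E : 'rV[R]_Nx -> R) (e : 'rV[R]_Nx -> 'rV[R]_Ne).
Context (eL eU : 'rV[R]_Ne) (x0 : 'rV[R]_Nx) (t0 : R).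

Definition lagrangian (nu0 : R) (nu : 'rV[R]_Ne) (x : 'rV[R]_Nx) : R :=
  nu0 * E x + dot nu (e x).

Definition hamiltonian (lx lv : 'rV[R]_Nx) (ly : R) (ls : 'rV[R]_Ne)
    (x v : 'rV[R]_Nx) (y : R) (s : 'rV[R]_Ne) (u : 'rV[R]_Nx) : R :=
  dot lx v + dot lv u + ly * dot (gradient E x) v + dot ls (v *m 'J e x).

Definition y_rhs (x v : 'rV[R]_Nx) : R := dot (gradient E x) v.
Definition s_rhs (x v : 'rV[R]_Nx) : 'rV[R]_Ne := v *m 'J e x.
Definition lx_rhs (ly : R) (ls : 'rV[R]_Ne) (x v : 'rV[R]_Nx) : 'rV[R]_Nx :=
  - (v *m hessian (lagrangian ly ls) x).
Definition lv_rhs (lx : 'rV[R]_Nx) (ly : R) (ls : 'rV[R]_Ne)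
    (x : 'rV[R]_Nx) : 'rV[R]_Nx :=
  - lx - gradient (lagrangian ly ls) x.

(* Points ((lx, lv, ly, ls), (x, v, y, s)); a notation, so that the normed
   module structure of the product is inferred. *)
Local Notation costate := ('rV[R]_Nx * 'rV[R]_Nx * R * 'rV[R]_Ne)%type.
Local Notation state := ('rV[R]_Nx * 'rV[R]_Nx * R * 'rV[R]_Ne)%type.
Local Notation phase := (costate * state)%type.

Definition phase_hamiltonian (z : phase) (u : 'rV[R]_Nx) : R :=
  let: ((lx, lv, ly, ls), (x, v, y, s)) := z in
  hamiltonian lx lv ly ls x v y s u.

Definition phase_rhs (z : phase) (u : 'rV[R]_Nx) : phase :=
  let: ((lx, lv, ly, ls), (x, v, y, s)) := z in
  ((lx_rhs ly ls x v, lv_rhs lx ly ls x, 0, 0),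
   (v, u, y_rhs x v, s_rhs x v)).

Definition dH_du (z : phase) (u : 'rV[R]_Nx) : 'rV[R]_Nx :=
  gradient (phase_hamiltonian z) u.

(* The expression in (z, u) of the k-th time derivative of dH/du obtained by
   substituting the state and adjoint equations.  The step from k to k + 1
   ignores du/dt, so it is only meaningful when the k-th expression is free
   of u; see [infinite_order], where this is required for every k. *)
Fixpoint dH_du_deriv (k : nat) : phase -> 'rV[R]_Nx -> 'rV[R]_Nx :=
  match k with
  | 0%N => dH_du
  | k'.+1 => fun z u =>
      'D_(phase_rhs z u) (fun z' : phase => dH_du_deriv k' z' u) z
  end.

Definition u_free (F : phase -> 'rV[R]_Nx -> 'rV[R]_Nx) : Prop :=
  forall z u u', F z u = F z u'.

Definition arc_phase (A : lifted_arc R Nx Ne) (t : R) : phase :=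
  ((arc_lx A t, arc_lv A t, arc_ly A t, arc_ls A t),
   (arc_x A t, arc_v A t, arc_y A t, arc_s A t)).

Definition feasible (A : lifted_arc R Nx Ne) : Prop :=
  let a := arc_ti A in let b := arc_tf A in
  let x := arc_x A in let v := arc_v A in let u := arc_u A in
  [/\ a < b,
      [/\ ac_deriv_vec a b x v,
          ac_deriv_vec a b v u,
          ac_deriv a b (arc_y A) (fun t => y_rhs (x t) (v t))
        & ac_deriv_vec a b (arc_s A) (fun t => s_rhs (x t) (v t))],
      [/\ x a = x0, a = t0, arc_y A a = E x0 & arc_s A a = e x0],
      v b = 0
    & forall i, eL 0 i <= arc_s A b 0 i <= eU 0 i].

Definition adjoint_equations (A : lifted_arc R Nx Ne) : Prop :=
  let a := arc_ti A in let b := arc_tf A in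
  let x := arc_x A in let v := arc_v A in
  let ly := arc_ly A in let ls := arc_ls A in
  [/\ ac_deriv_vec a b (arc_lx A) (fun t => lx_rhs (ly t) (ls t) (x t) (v t)),
      ac_deriv_vec a b (arc_lv A)
        (fun t => lv_rhs (arc_lx A t) (ly t) (ls t) (x t)),
      ac_deriv a b ly (fun=> 0)
    & ac_deriv_vec a b ls (fun=> 0)].

Definition hamiltonian_minimization (A : lifted_arc R Nx Ne) : Prop :=
  forall t, t \in `[arc_ti A, arc_tf A] ->
    (forall w, phase_hamiltonian (arc_phase A t) (arc_u A t)
               <= phase_hamiltonian (arc_phase A t) w) /\
    dH_du (arc_phase A t) (arc_u A t) = 0.

(* Sign conditions on a final multiplier [nu] for l <= s <= r; there is no
   condition when l = r. *)
Definition complementarity (l r s nu : R) : Prop :=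
  l < r ->
  [/\ s = l -> nu <= 0, l < s < r -> nu = 0 & s = r -> 0 <= nu].

Definition transversality (A : lifted_arc R Nx Ne) (nu0 : R) : Prop :=
  let a := arc_ti A in let b := arc_tf A in
  [/\ arc_lx A b = 0,
      arc_lv A a = 0,
      exists nuv : 'rV[R]_Nx, arc_lv A b = nuv,
      arc_ly A b = nu0
    & exists nus : 'rV[R]_Ne, arc_ls A b = nus /\
        forall i, complementarity (eL 0 i) (eU 0 i) (arc_s A b 0 i) (nus 0 i)].

Definition nontrivial (A : lifted_arc R Nx Ne) (nu0 : R) : Prop :=
  nu0 <> 0 \/
  exists2 t, t \in `[arc_ti A, arc_tf A] & (arc_phase A t).1 <> 0.

Definition extremal (A : lifted_arc R Nx Ne) : Prop :=
  feasible A /\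
  exists2 nu0 : R, 0 <= nu0 &
    [/\ nontrivial A nu0, adjoint_equations A, hamiltonian_minimization A
      & transversality A nu0].

Definition zero_hamiltonian (A : lifted_arc R Nx Ne) : Prop :=
  forall t, t \in `[arc_ti A, arc_tf A] ->
    phase_hamiltonian (arc_phase A t) (arc_u A t) = 0.

Definition singular_arc (A : lifted_arc R Nx Ne) : Prop :=
  [/\ extremal A,
      forall t, t \in `[arc_ti A, arc_tf A] ->
        dH_du (arc_phase A t) (arc_u A t) = 0
    & u_free dH_du].

Definition infinite_order (A : lifted_arc R Nx Ne) : Prop :=
  forall k : nat,
    [/\ forall z u, derivable (fun z' : phase => dH_du_deriv k z' u) z
                      (phase_rhs z u),
        u_free (dH_du_deriv k),
        nth_deriv_within (arc_ti A) (arc_tf A) k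
          (fun t => dH_du (arc_phase A t) (arc_u A t))
          (fun t => dH_du_deriv k (arc_phase A t) (arc_u A t))
      & forall t, t \in `[arc_ti A, arc_tf A] ->
          dH_du_deriv k (arc_phase A t) (arc_u A t) = 0].

End ProblemM.

(* Main.v *)
Require Import Defs.
From mathcomp Require Import all_boot all_order all_algebra.
From mathcomp Require Import all_classical all_reals all_analysis.
Import Order.TTheory GRing.Theory Num.Theory.
Import numFieldNormedType.Exports.
Set Implicit Arguments.
Unset Strict Implicit.
Unset Printing Implicit Defensive.

Local Open Scope classical_set_scope.
Local Open Scope ring_scope.

(** The Hamiltonian is affine in the control and dH/du is the covector
[lambda_v], whatever [u] is.  Hence the first-order condition says that
[lambda_v] vanishes on the whole of [[t_0, t_f]], and it never determines [u].
Two facts follow.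

- Since [lambda_v] is identically zero and is the integral of
  [phi := - lambda_x - dL/dx(lambda_y, lambda_s, x)], this [phi] vanishes almost
  everywhere.  It is continuous, because [lambda_y] and [lambda_s] are constant
  and [L] is C2, so it vanishes everywhere ([extremal_lv_rhs0]).  The terms of
  the Hamiltonian regroup as [H = lambda_v . u - phi . v]
  ([phase_hamiltonianE]), so [H = 0].

- Differentiate dH/du formally along the state and adjoint equations: the first
  derivative is [phi], and the second is
  [- d(lambda_x)/dt - (d2L/dx2) v], which is identically zero on phase space
  because it is exactly what the adjoint equation for [lambda_x] cancels
  ([is_derive_phase_lv_rhs]).  All later derivatives are then zero as
  well, none of these expressions contains [u], and all of them vanish along an
  extremal, which is infinite order. *)

(** * The dot product *)

Section DotProduct.
Context {R : realType} {n : nat}.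
Implicit Types a b c : 'rV[R]_n.

Lemma dot0l b : dot 0 b = 0.
Proof. by apply: big1 => i _; rewrite mxE mul0r. Qed.

Lemma dotDl a b c : dot (a + b) c = dot a c + dot b c.
Proof. by rewrite -big_split; apply: eq_bigr => i _; rewrite mxE mulrDl. Qed.

Lemma dotNl a c : dot (- a) c = - dot a c.
Proof. by rewrite -sumrN; apply: eq_bigr => i _; rewrite mxE mulNr. Qed.

Lemma dot_delta a j : dot a (delta_mx 0 j) = a 0 j.
Proof.
rewrite /dot (bigD1 j)//= mxE !eqxx mulr1 big1 ?addr0// => i ij.
by rewrite mxE (negPf ij) andbF mulr0.
Qed.

End DotProduct.

(** * Functions with values in row vectors *)

Section RowVectorFunctions.
Context {R : realType} {V : normedModType R} {n : nat}.
Implicit Types (f : V -> 'rV[R]_n) (x v : V).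

Lemma differentiable_entry f x i :
  differentiable f x -> differentiable (fun z => f z 0 i) x.
Proof.
move=> df; exact: (differentiable_comp df (differentiable_coord (f x) 0 i)).
Qed.

Lemma is_derive_entry f x v i :
  differentiable f x -> is_derive x v (fun z => f z 0 i) ('D_v f x 0 i).
Proof.
move=> df; have dfv : derivable f x v by exact: diff_derivable.
apply: DeriveDef; first exact: (derivable_mxP f x v).1.
by rewrite derive_mx// mxE.
Qed.

(** Turns the entrywise regularity that [C2] provides, one partial derivative at
a time, into the differentiability of a whole gradient, which is what makes the
Hessian a genuine derivative. *)
Lemma differentiable_row f x :
  (forall i, differentiable (fun z => f z 0 i) x) -> differentiable f x.
Proof.
move=> df.
have -> : f = \sum_(i < n) (fun z => f z 0 i *: (delta_mx 0 i : 'rV[R]_n)).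
  by apply/funext => z; rewrite fct_sumE; exact: row_sum_delta.
by apply: differentiable_sum => i; exact: differentiableZl.
Qed.

Lemma cvg_row (T : Type) (F : set_system T) (g : T -> 'rV[R]_n)
    (l : 'rV[R]_n) :
  Filter F -> (forall i, g t 0 i @[t --> F] --> l 0 i) -> g @ F --> l.
Proof.
move=> FF cg.
have -> : g = fun t => \sum_(i < n) g t 0 i *: (delta_mx 0 i : 'rV[R]_n).
  by apply/funext => t; exact: row_sum_delta.
rewrite (row_sum_delta l).
apply: cvg_big => [|i _]; first exact: add_continuous.
apply: cvgZr_tmp; exact: cg.
Qed.

End RowVectorFunctions.

(** * Gradients *)

Section Gradient.
Context {R : realType} {n : nat}.

Lemma gradientE (f : 'rV[R]_n -> R) x i :
  gradient f x 0 i = 'D_(delta_mx 0 i) f x.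
Proof. by rewrite mxE. Qed.

Lemma dot_gradient (f : 'rV[R]_n -> R) x v :
  differentiable f x -> dot (gradient f x) v = 'D_v f x.
Proof.
move=> df; rewrite deriveE// [in RHS](row_sum_delta v) linear_sum /=.
by apply: eq_bigr => i _; rewrite gradientE deriveE// linearZ /= mulrC.
Qed.

End Gradient.

(** * Regularity of the Lagrangian *)

Section Lagrangian.
Context {R : realType} {Nx Ne : nat}.
Implicit Types (E : 'rV[R]_Nx -> R) (e : 'rV[R]_Nx -> 'rV[R]_Ne).
Implicit Types (c : R) (nu : 'rV[R]_Ne) (x v : 'rV[R]_Nx).

Lemma lagrangianE E e c nu :
  lagrangian E e c nu =
  c *: E + \sum_(i < Ne) nu 0 i *: (fun z => e z 0 i).
Proof. by apply/funext => x; rewrite /lagrangian fctE fct_sumE. Qed.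

Lemma differentiable_lagrangian E e c nu x :
  differentiable E x -> differentiable e x ->
  differentiable (lagrangian E e c nu) x.
Proof.
move=> dE de; rewrite lagrangianE; apply: differentiableD.
  exact: differentiableZ.
apply: differentiable_sum => i.
exact/differentiableZ/differentiable_entry.
Qed.

(** The Lagrangian is linear in the pair (E, e), so differentiating it amounts to
forming the Lagrangian of the derivatives.  In this form regularity of the
Lagrangian also gives regularity of its partial derivatives. *)
Lemma derive_lagrangian E e c nu x v :
  differentiable E x -> differentiable e x ->
  'D_v (lagrangian E e c nu) x = lagrangian ('D_v E) ('D_v e) c nu x.
Proof.
move=> dE de; rewrite lagrangianE.
have dEv : is_derive x v E ('D_v E x) by exact/derivableP/diff_derivable.
have dev i : is_derive x v (fun z => e z 0 i) ('D_v e x 0 i).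
  exact: is_derive_entry.
by rewrite derive_val.
Qed.

Lemma differentiable_gradient_lagrangian E e c nu x :
  C2 E -> C2 e -> differentiable (gradient (lagrangian E e c nu)) x.
Proof.
move=> [dE dDE _] [de dDe _]; apply: differentiable_row => i.
have -> : (fun z => gradient (lagrangian E e c nu) z 0 i) =
    lagrangian ('D_(delta_mx 0 i) E) ('D_(delta_mx 0 i) e) c nu.
  by apply/funext => z; rewrite gradientE derive_lagrangian.
exact: differentiable_lagrangian.
Qed.

End Lagrangian.

(** * Derivatives along lines *)

Section DirectionalDerivatives.
Context {R : realType} {V W U : normedModType R}.

(** A directional derivative only sees the restriction to a line.  On phase space
this freezes the coordinates with zero velocity: along the flow the multipliers
[lambda_y] and [lambda_s] stay fixed, and no smoothness jointly in the
multipliers and [x] has to be considered. *)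
Lemma is_derive_along_line (f : V -> U) (g : W -> U) z w x v d :
  (forall h : R, f (h *: w + z) = g (h *: v + x)) ->
  is_derive x v g d -> is_derive z w f d.
Proof.
move=> fg [dg <-].
have fgq : (fun h : R => h^-1 *: ((f \o shift z) (h *: w) - f z)) =
    (fun h => h^-1 *: ((g \o shift x) (h *: v) - g x)).
  apply/funext => h /=; rewrite fg; congr (_ *: (_ - _)).
  by have := fg 0; rewrite !scale0r !add0r.
by split; rewrite /derivable /derive fgq.
Qed.

End DirectionalDerivatives.

(** * Absolutely continuous functions on a segment *)

Section AbsolutelyContinuous.
Context {R : realType}.
Variables a b : R.
Hypothesis ab : a < b.

Lemma ac_deriv_continuous (f f' : R -> R) :
  ac_deriv a b f f' -> {within `[a, b], continuous f}.
Proof.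
move=> [intf' fE].
apply: (@subspace_eq_continuous _ _ _
  (fun t => f a + \int[lebesgue_measure]_(r in `[a, t]) f' r)).
  by move=> t; rewrite inE => /fE/esym.
move=> t; apply: cvgD; first exact: cvg_cst.
exact: (parameterized_integral_continuous (ltW ab) intf').
Qed.

Lemma ac_deriv_vec_continuous n (f f' : R -> 'rV[R]_n) :
  ac_deriv_vec a b f f' -> {within `[a, b], continuous f}.
Proof.
move=> acf t; apply: cvg_row => i.
exact: (ac_deriv_continuous (acf i)).
Qed.

Lemma ac_deriv0_cst (f : R -> R) t :
  ac_deriv a b f (fun=> 0) -> t \in `[a, b] -> f t = f a.
Proof.
by move=> [_ fE] /fE ->; rewrite Rintegral_cst// mul0r addr0.
Qed.

(** At interior points the fundamental theorem of calculus recovers [f'] as the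
derivative of its integral from [a], which is constantly zero; the endpoints
follow by continuity. *)
Lemma ac_deriv_eq0 (f f' : R -> R) :
  ac_deriv a b f f' -> {within `[a, b], continuous f'} ->
  {in `[a, b], forall t, f t = 0} -> {in `[a, b], forall t, f' t = 0}.
Proof.
move=> [intf' fE] /(continuous_within_itvP _ ab)[cf' f'a f'b] f0.
have aab : a \in `[a, b] by rewrite bound_itvE ltW.
have f'0 t : t \in `]a, b[ -> f' t = 0.
  move=> tab; have /andP[at_ tb] : a < t < b by rewrite in_itv in tab.
  have [_ <-] := @continuous_FTC1 R f' (BLeft a) t b tb intf' at_ (cf' _ tab).
  rewrite derive1E -[RHS](derive_cst (0 : R) t (1 : R)).
  apply: near_eq_derive => //.
  near=> r.
  have rab : r \in `[a, b].
    apply: subset_itv_oo_cc; near: r; exact: near_in_itvoo.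
  by have := fE _ rab; rewrite !f0// add0r => <-.
move=> t; rewrite in_itv /= le_eqVlt => /andP[/predU1P[<- _|at_]].
  have := cvg_unique _ f'a; apply => //.
  apply: cvg_near_cst.
  by near=> r; rewrite f'0// in_itv/=; apply/andP; split; near: r;
    [exact: nbhs_right_gt|exact: nbhs_right_lt].
rewrite le_eqVlt => /predU1P[->|tb]; last by rewrite f'0// in_itv /= at_ tb.
have := cvg_unique _ f'b; apply => //.
apply: cvg_near_cst.
by near=> r; rewrite f'0// in_itv/=; apply/andP; split; near: r;
  [exact: nbhs_left_gt|exact: nbhs_left_lt].
Unshelve. all: by end_near. Qed.

Lemma deriv_within_eq0 (V : normedModType R) (f : R -> V) t :
  {in `[a, b], forall r, f r = 0} -> t \in `[a, b] -> deriv_within a b f t 0.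
Proof.
move=> f0 tab; apply: cvg_near_cst.
by near=> h; rewrite !f0 ?subr0 ?scaler0//; near: h; exact: withinT.
Unshelve. all: by end_near. Qed.

End AbsolutelyContinuous.

(** * The successive derivatives of dH/du *)

Section SingularArcs.
Context {R : realType} {Nx Ne : nat}.
Variables (E : 'rV[R]_Nx -> R) (e : 'rV[R]_Nx -> 'rV[R]_Ne).
Hypotheses (hE : C2 E) (he : C2 e).

Local Notation costate := ('rV[R]_Nx * 'rV[R]_Nx * R * 'rV[R]_Ne)%type.
Local Notation state := ('rV[R]_Nx * 'rV[R]_Nx * R * 'rV[R]_Ne)%type.
Local Notation phase := (costate * state)%type.

Definition phase_lv (z : phase) : 'rV[R]_Nx := z.1.1.1.2.

Definition phase_lv_rhs (z : phase) : 'rV[R]_Nx :=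
  lv_rhs E e z.1.1.1.1 z.1.1.2 z.1.2 z.2.1.1.1.

(** As a function of [u], H is [lambda_v . u] plus a constant. *)
Lemma dH_duE z u : dH_du E e z u = phase_lv z.
Proof.
case: z => [[[[lx lv] ly] ls] [[[x v] y] s]]; apply/rowP => j.
rewrite gradientE /=; set d := delta_mx 0 j.
suff dH : is_derive u d
    (phase_hamiltonian E e ((lx, lv, ly, ls), (x, v, y, s))) (dot lv d).
  by rewrite derive_val dot_delta.
have -> : phase_hamiltonian E e ((lx, lv, ly, ls), (x, v, y, s)) =
    cst (dot lx v) + \sum_(i < Nx) lv 0 i *: (fun w : 'rV[R]_Nx => w 0 i)
    + cst (ly * dot (gradient E x) v) + cst (dot ls (v *m 'J e x)).
  by apply/funext => w; rewrite !fctE fct_sumE.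
have dc i : is_derive u d (fun w : 'rV[R]_Nx => w 0 i) (d 0 i).
  have := @is_derive_entry _ _ _ id u d i; rewrite derive_id; apply.
  exact: ex_diff.
by apply: is_derive_eq; rewrite add0r !addr0.
Qed.

Lemma is_derive_phase_lv z u :
  is_derive z (phase_rhs E e z u) phase_lv (phase_lv_rhs z).
Proof.
case: z => [[[[lx lv] ly] ls] [[[x v] y] s]].
exact: (@is_derive_along_line _ _ _ _ _ id _ _ lv).
Qed.

(** The cancellation behind infinite order: the flow moves [- lambda_x] with speed
[(d2L/dx2) v] by the adjoint equation, and [- dL/dx] with speed
[- (d2L/dx2) v] by the chain rule. *)
Lemma is_derive_phase_lv_rhs z u :
  is_derive z (phase_rhs E e z u) phase_lv_rhs 0.
Proof.
case: z => [[[[lx lv] ly] ls] [[[x v] y] s]].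
set z := ((lx, lv, ly, ls), (x, v, y, s)).
set w := phase_rhs E e z u.
pose gradL (z' : phase) := gradient (lagrangian E e z'.1.1.2 z'.1.2) z'.2.1.1.1.
have -> : phase_lv_rhs = - (fun z' : phase => z'.1.1.1.1) - gradL by [].
have dlx : is_derive z w (fun z' : phase => z'.1.1.1.1) (lx_rhs E e ly ls x v).
  exact: (@is_derive_along_line _ _ _ _ _ id _ _ lx).
have dgradL : is_derive z w gradL (v *m hessian (lagrangian E e ly ls) x).
  have dG : differentiable (gradient (lagrangian E e ly ls)) x.
    exact: differentiable_gradient_lagrangian.
  apply: (@is_derive_along_line _ _ _ _ _
      (gradient (lagrangian E e ly ls)) _ _ x v) => [h|].
    by rewrite /gradL /= !scaler0 !add0r.
  by apply: DeriveDef; [exact: diff_derivable|exact: deriveEjacobian].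
by apply: is_derive_eq; rewrite /lx_rhs opprK subrr.
Qed.

Lemma dH_du_deriv1E z u : dH_du_deriv E e 1 z u = phase_lv_rhs z.
Proof.
rewrite /=; under eq_fun do rewrite dH_duE.
by have := is_derive_phase_lv z u; case.
Qed.

Lemma dH_du_deriv_ge2E k z u : dH_du_deriv E e k.+2 z u = 0.
Proof.
elim: k z => [|k IHk] z.
  (* Exposes only the outermost derivative of the recursion. *)
  rewrite -[LHS]/('D_(phase_rhs E e z u) (fun z' => dH_du_deriv E e 1 z' u) z).
  under eq_fun do rewrite dH_du_deriv1E.
  by have := is_derive_phase_lv_rhs z u; case.
rewrite -[LHS]/('D_(phase_rhs E e z u) (fun z' => dH_du_deriv E e k.+2 z' u) z).
by under eq_fun do rewrite IHk; exact: derive_cst.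
Qed.

Lemma dH_du_deriv_u_free k : u_free (dH_du_deriv E e k).
Proof.
move=> z u u'; case: k => [|[|k]]; first by rewrite /= !dH_duE.
  by rewrite !dH_du_deriv1E.
by rewrite !dH_du_deriv_ge2E.
Qed.

Lemma derivable_dH_du_deriv k z u :
  derivable (fun z' => dH_du_deriv E e k z' u) z (phase_rhs E e z u).
Proof.
case: k => [|[|k]].
- by under eq_fun do rewrite /= dH_duE; have := is_derive_phase_lv z u; case.
- under eq_fun do rewrite dH_du_deriv1E.
  by have := is_derive_phase_lv_rhs z u; case.
- by under eq_fun do rewrite dH_du_deriv_ge2E; exact: derivable_cst.
Qed.

(** The [lambda_y] and [lambda_s] terms of H together are the derivative of the
Lagrangian in the direction [v], so they combine with [lambda_x . v] into
[- phase_lv_rhs . v]. *)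
Lemma phase_hamiltonianE z u :
  phase_hamiltonian E e z u =
  dot (phase_lv z) u - dot (phase_lv_rhs z) z.2.1.1.2.
Proof.
case: z => [[[[lx lv] ly] ls] [[[x v] y] s]].
have [[dE _ _] [de _ _]] := (hE, he).
rewrite /phase_lv_rhs /lv_rhs /= dotDl !dotNl dot_gradient; last first.
  exact: differentiable_lagrangian.
rewrite derive_lagrangian// /lagrangian /hamiltonian dot_gradient//.
rewrite -deriveEjacobian// -opprD opprK !addrA.
by rewrite [dot lx v + _]addrC.
Qed.

(** * Extremals *)

Section AlongExtremals.
Variables (eL eU : 'rV[R]_Ne) (x0 : 'rV[R]_Nx) (t0 : R).
Variable A : lifted_arc R Nx Ne.
Hypothesis extA : extremal E e eL eU x0 t0 A.

Let a := arc_ti A.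
Let b := arc_tf A.

Lemma extremal_lv0 t : t \in `[a, b] -> phase_lv (arc_phase A t) = 0.
Proof.
by case: extA => _ [c _ [_ _ minA _]] /minA[_]; rewrite dH_duE.
Qed.

(** [lambda_v] is identically zero, so its almost-everywhere derivative vanishes;
continuity of that derivative upgrades this to every time, endpoints
included. *)
Lemma extremal_lv_rhs0 t : t \in `[a, b] -> phase_lv_rhs (arc_phase A t) = 0.
Proof.
case: extA => -[ab [acx _ _ _] _ _ _] [c _ [_ [aclx aclv acly acls] _ _]] tab.
pose ly := arc_ly A a; pose ls := arc_ls A a.
have lyE r : r \in `[a, b] -> arc_ly A r = ly by exact: ac_deriv0_cst.
have lsE r : r \in `[a, b] -> arc_ls A r = ls.
  move=> rab; apply/rowP => i.
  apply: (@ac_deriv0_cst _ a b (fun t => arc_ls A t 0 i)) => //.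
  have := acls i; congr (ac_deriv _ _ _ _).
  by apply/funext => r'; rewrite mxE.
have cgrad : {within `[a, b], continuous
    (fun r => gradient (lagrangian E e ly ls) (arc_x A r))}.
  move=> r; apply: continuous_comp.
    exact: (ac_deriv_vec_continuous ab acx).
  exact/differentiable_continuous/differentiable_gradient_lagrangian.
have clv : {within `[a, b], continuous
    (fun r => lv_rhs E e (arc_lx A r) ly ls (arc_x A r))}.
  move=> r; apply: cvgB; last exact: cgrad.
  by apply: cvgN; exact: (ac_deriv_vec_continuous ab aclx).
apply/rowP => i; rewrite [RHS]mxE.
apply: (ac_deriv_eq0 ab (aclv i)) => // [|r rab].
  apply: (@subspace_eq_continuous _ _ _
    (fun r => lv_rhs E e (arc_lx A r) ly ls (arc_x A r) 0 i)).
    by move=> r; rewrite inE => rab; rewrite -(lyE _ rab) -(lsE _ rab).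
  move=> r; have cr := @coord_continuous R 1 Nx 0 i
    (lv_rhs E e (arc_lx A r) ly ls (arc_x A r)).
  exact: (continuous_comp (clv r) cr).
by have := extremal_lv0 rab; rewrite /phase_lv /= => ->; rewrite mxE.
Qed.

Lemma dH_du_deriv_arc0 k t : t \in `[a, b] ->
  dH_du_deriv E e k (arc_phase A t) (arc_u A t) = 0.
Proof.
move=> tab; case: k => [|[|k]]; last by rewrite dH_du_deriv_ge2E.
  by rewrite /= dH_duE extremal_lv0.
by rewrite dH_du_deriv1E extremal_lv_rhs0.
Qed.

(** Each derivative vanishes on the whole interval, so the limits required at
successive orders, one-sided at the endpoints, are those of the zero
function. *)
Lemma extremal_infinite_order : infinite_order E e A.
Proof.
move=> k; split.
- exact: derivable_dH_du_deriv.
- exact: dH_du_deriv_u_free.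
- elim: k => [//|k IHk].
  exists (fun t => dH_du_deriv E e k (arc_phase A t) (arc_u A t)).
  split=> // t tab; rewrite (dH_du_deriv_arc0 k.+1 tab).
  by apply: deriv_within_eq0 => // r; exact: dH_du_deriv_arc0.
- by move=> t; exact: dH_du_deriv_arc0.
Qed.

Lemma extremal_zero_hamiltonian : zero_hamiltonian E e A.
Proof.
move=> t tab.
rewrite phase_hamiltonianE extremal_lv0// extremal_lv_rhs0//.
by rewrite !dot0l subr0.
Qed.

Lemma extremal_singular : singular_arc E e eL eU x0 t0 A.
Proof.
split=> // [t tab|]; first by rewrite dH_duE extremal_lv0.
exact: (dH_du_deriv_u_free 0).
Qed.

End AlongExtremals.

End SingularArcs.

Theorem theorem2p4 (R : realType) (Nx Ne : nat) (hNx : (1 <= Nx)%N)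
    (E : 'rV[R]_Nx -> R) (e : 'rV[R]_Nx -> 'rV[R]_Ne)
    (eL eU : 'rV[R]_Ne) (x0 : 'rV[R]_Nx) (t0 : R)
    (hE : C2 E) (he : C2 e) (hLU : forall i, eL 0 i <= eU 0 i) :
  (forall A : lifted_arc R Nx Ne, extremal E e eL eU x0 t0 A ->
     singular_arc E e eL eU x0 t0 A /\ zero_hamiltonian E e A) /\
  (forall A : lifted_arc R Nx Ne, singular_arc E e eL eU x0 t0 A ->
     infinite_order E e A).
Proof.
split=> A; last by case=> extA _ _; exact: (extremal_infinite_order hE he extA).
move=> extA; split; first exact: (extremal_singular hE he extA).
exact: (extremal_zero_hamiltonian hE he extA).
Qed.
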